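(* Let $M$ be a matroid that is not OTE. Then $M$ is not sticky.
   Context: A modular cut of a matroid $M$ is a set $\mathcal{M}$ of flats of $M$ such that (1) if $F\in\mathcal{M}$ and $F'\supseteq F$ is a flat, then $F'\in\mathcal{M}$; (2) if $F_1,F_2\in\mathcal{M}$ and $(F_1,F_2)$ is a modular pair, i.e. $\operatorname{rk}(F_1)+\operatorname{rk}(F_2)=\operatorname{rk}(F_1\cup F_2)+\operatorname{rk}(F_1\cap F_2)$, then $F_1\cap F_2\in\mathcal{M}$. For a flat $F$, the principal modular cut is $\mathcal{M}_F=\{G: G \text{ a flat}, G\supseteq F\}$. A matroid is OTE if every modular cut other than the empty one is principal. An extension of a matroid $M$ on $E$ is a matroid $N$ on $F\supseteq E$ with $N|E=M$. If $N_1,N_2$ are extensions of $M$ on ground sets $F_1,F_2$ with $F_1\cap F_2=E$, an amalgam is a matroid on $F_1\cup F_2$ whose restriction to $F_i$ is $N_i$. $M$ is sticky if an amalgam exists for every such pair of extensions. *)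

(* Defs.v *)
From HB Require Import structures.
From mathcomp Require Import all_boot.
From mathcomp Require Export finmap.

Set Implicit Arguments.
Unset Strict Implicit.
Unset Printing Implicit Defensive.

Local Open Scope fset_scope.

(* Finite matroids, presented by their rank function.  Ground sets are finite
   subsets of an ambient type K of potential elements, so that extensions,
   intersections and unions of ground sets are literal ones.
   [rk] is only meaningful on subsets of [ground]: its values elsewhere are
   arbitrary, and none of the definitions below depends on them. *)
Record matroid (K : choiceType) := Matroid {
  ground : {fset K};
  rk : {fset K} -> nat;
  rk_card : forall X : {fset K}, X `<=` ground -> rk X <= #|` X|;
  rk_mono : forall X Y : {fset K},
    X `<=` Y -> Y `<=` ground -> rk X <= rk Y;
  rk_submod : forall X Y : {fset K}, X `<=` ground -> Y `<=` ground ->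
    rk (X `|` Y) + rk (X `&` Y) <= rk X + rk Y
}.

(* Extensions can then always use new elements. *)
Definition infinite_universe (K : choiceType) : Prop :=
  forall A : {fset K}, exists x : K, x \notin A.

Section Matroids.
Variable K : choiceType.
Implicit Types (M N : matroid K) (F G X : {fset K}) (C : {fset {fset K}}).

Definition flat M F : Prop :=
  F `<=` ground M /\
  (forall x, x \in ground M -> x \notin F -> rk M F < rk M (x |` F)).

Definition modular_pair M F G : Prop :=
  (rk M F + rk M G = rk M (F `|` G) + rk M (F `&` G))%N.

Definition modular_cut M C : Prop :=
  [/\ forall F, F \in C -> flat M F,
      forall F G, F \in C -> flat M G -> F `<=` G -> G \in C
    & forall F G, F \in C -> G \in C -> modular_pair M F G -> F `&` G \in C].

Definition principal M C : Prop :=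
  exists2 F, flat M F & forall G, G \in C <-> flat M G /\ F `<=` G.

Definition OTE M : Prop :=
  forall C, modular_cut M C -> C <> fset0 -> principal M C.

(* N restricts to M on the ground set of M: a matroid is determined by the
   ranks of the subsets of its ground set, and restriction keeps these ranks. *)
Definition extension N M : Prop :=
  ground M `<=` ground N /\
  (forall X, X `<=` ground M -> rk N X = rk M X).

Definition amalgam A N1 N2 : Prop :=
  [/\ ground A = ground N1 `|` ground N2, extension A N1 & extension A N2].

Definition sticky M : Prop :=
  forall N1 N2 : matroid K, extension N1 M -> extension N2 M ->
    ground N1 `&` ground N2 = ground M ->
    exists A : matroid K, amalgam A N1 N2.

End Matroids.

(* Main.v *)
Require Import Defs.
From mathcomp Require Import all_boot finmap.
From mathcomp Require Import zify.

(* Let [C] be a non-principal modular cut and choose [F1], [F2] in [C] with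
   [I = F1 `&` F2] not in [C] and with least modular defect [d > 0].  Keep only
   the members of [C] containing [I], and let [mu X] be the least rank of such a
   flat containing [X].  Since [d] is least, [mu] is nearly submodular, and
   - [d] new elements [P] can be added freely subject to lying in the closures
     of both [F1] and [F2], so that [rk (I `|` P) = rk I + d];
   - two sets [Q], [Q'] of [d + s] new elements can be added, each raising the
     ranks of [F1], [F2] and [F1 `|` F2] by exactly [s], while
     [rk (I `|` Q `|` Q') = rk I + d + 2 * s + 1].
   In an amalgam, [Q] and [Q'] would both be forced to span [P] over [I] with
   [rk (I `|` Q `|` P)] and [rk (I `|` Q' `|` P)] at most [rk I + d + s]; by
   submodularity [rk (I `|` Q `|` Q') <= rk I + d + 2 * s], a contradiction.
   This is a relative of the Vamos matroid, which is the case [d = s = 1]. *)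

Set Implicit Arguments.
Unset Strict Implicit.
Unset Printing Implicit Defensive.

Local Open Scope fset_scope.
Local Open Scope nat_scope.

(** * Fresh elements and flat closures *)

Lemma exists_fresh_fset (K : choiceType) (HK : infinite_universe K)
    (A : {fset K}) n :
  exists2 B : {fset K}, #|` B| = n & A `&` B = fset0.
Proof.
elim: n => [|n [B cB AB]]; first by exists fset0; rewrite ?cardfs0 ?fsetI0.
have [x] := HK (A `|` B); rewrite in_fsetU negb_or => /andP [xA xB].
exists (x |` B); first by rewrite cardfsU1 xB cB.
by rewrite fsetIUr AB fsetU0; apply/eqP; rewrite fsetI_eq0 fdisjointX1.
Qed.

Section Closure.
Variables (K : choiceType) (M : matroid K).

(** Elements that do not raise the rank are added one at a time until none is left. *)
Lemma exists_flat_span (X : {fset K}) : X `<=` ground M ->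
  exists F, [/\ flat M F, X `<=` F & rk M F = rk M X].
Proof.
move=> XE; have [n] := ubnP (#|` ground M| - #|` X|).
elim: n X XE => // n IHn X XE lt_n.
case: (boolP (all (fun x => (x \in X) || (rk M X < rk M (x |` X)))
                  (ground M))) => [/allP allx | /allPn [x xE]].
  exists X; split=> //; split=> // x xE xX.
  by have := allx x xE; rewrite (negPf xX).
rewrite negb_or -leqNgt => /andP [xX le_rk].
have xXE : x |` X `<=` ground M by rewrite fsubUset fsub1set xE.
have [||F [fF XF rF]] := IHn (x |` X) => //.
  have := fsubset_leq_card xXE; rewrite cardfsU1 xX; lia.
exists F; split=> //; first by apply: fsubset_trans XF; apply: fsubsetUr.
by have := rk_mono (fsubsetUr [fset x] X) xXE; lia.
Qed.

End Closure.

(** * Extensions by freely placed new elements *)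

(* A common generalisation of principal extension and truncation: the elements
   of [T] are placed freely subject to the bounds [mu X + e S] and [R] on the
   rank of [X `|` S].  The last hypothesis on [e] is what makes up for the
   failure, by [d], of submodularity of [mu]. *)
Section Extend.
Variables (K : choiceType) (M : matroid K) (mu : {fset K} -> nat) (d m0 : nat).
Local Notation E := (ground M).
Hypotheses
  (rk_le_mu : forall X, X `<=` E -> rk M X <= mu X)
  (mu_mono : forall X Y, X `<=` Y -> Y `<=` E -> mu X <= mu Y)
  (mu_rk_submod : forall X Y, X `<=` E -> Y `<=` E ->
     mu (X `|` Y) + rk M (X `&` Y) <= rk M X + mu Y)
  (mu_submod : forall X Y, X `<=` E -> Y `<=` E ->
     mu (X `|` Y) + minn (mu (X `&` Y)) (rk M (X `&` Y) + d) <= mu X + mu Y)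
  (mu_ge : forall X, X `<=` E -> m0 <= mu X).
Variables (T : {fset K}) (e : {fset K} -> nat) (R : nat).
Hypotheses
  (ET : E `&` T = fset0)
  (le_R : rk M E <= R)
  (e_mono : forall S S' : {fset K}, S `<=` S' -> e S <= e S')
  (e_card : forall S S' : {fset K}, S `<=` T -> S' `<=` T ->
     e (S `|` S') + #|` S `&` S'| <= #|` S| + e S')
  (e_submod : forall S S' : {fset K}, e (S `|` S') + e (S `&` S') <= e S + e S')
  (e_defect : forall S S' : {fset K}, S `<=` T -> S' `<=` T ->
     #|` S `&` S'| + e (S `|` S') <= d + (e S + e S') \/
     R <= m0 + e S /\ R <= m0 + e S').

Definition extend_rk (X : {fset K}) :=
  minn (minn (rk M (X `&` E) + #|` X `&` T|) (mu (X `&` E) + e (X `&` T))) R.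

Local Lemma extend_rk_card X : X `<=` E `|` T -> extend_rk X <= #|` X|.
Proof.
move=> /fsetIidPl XET; have := rk_card (fsubsetIr X E).
have := cardfsUI (X `&` E) (X `&` T).
rewrite -fsetIUr XET fsetIACA ET fsetI0 cardfs0 /extend_rk; lia.
Qed.

Local Lemma extend_rk_mono X Y :
  X `<=` Y -> Y `<=` E `|` T -> extend_rk X <= extend_rk Y.
Proof.
move=> XY _; have sE := fsetSI E XY; have sT := fsetSI T XY.
have := rk_mono sE (fsubsetIr Y E); have := mu_mono sE (fsubsetIr Y E).
have := fsubset_leq_card sT; have := e_mono sT; rewrite /extend_rk; lia.
Qed.

(** Cases on the terms attaining the two minima on the right. Two free terms use [rk_submod]; a
    mixed pair uses [mu_rk_submod] and [e_card]. Two [mu] terms use [mu_submod], with [e_submod] or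
    the first case of [e_defect] according to its [minn]; in the second case of [e_defect] both
    terms are at least [R]. A value [R] is handled by monotonicity. *)
Local Lemma extend_rk_submod X Y : X `<=` E `|` T -> Y `<=` E `|` T ->
  extend_rk (X `|` Y) + extend_rk (X `&` Y) <= extend_rk X + extend_rk Y.
Proof.
move=> _ _; rewrite /extend_rk !fsetIUl.
have -> : (X `&` Y) `&` E = (X `&` E) `&` (Y `&` E) by rewrite fsetIACA fsetIid.
have -> : (X `&` Y) `&` T = (X `&` T) `&` (Y `&` T) by rewrite fsetIACA fsetIid.
move: (fsubsetIr X E) (fsubsetIr Y E) (fsubsetIr X T) (fsubsetIr Y T).
move: (X `&` E) (Y `&` E) (X `&` T) (Y `&` T) => A B S S' AE BE ST S'T.
have ABA : A `&` B `<=` A by exact: fsubsetIl.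
have ABB : A `&` B `<=` B by exact: fsubsetIr.
have := rk_submod AE BE.
have := mu_rk_submod AE BE.
have := mu_rk_submod BE AE; rewrite (fsetUC B) (fsetIC B).
have := mu_submod AE BE.
have := mu_ge AE; have := mu_ge BE.
have := rk_mono ABA AE; have := rk_mono ABB BE.
have := mu_mono ABA AE; have := mu_mono ABB BE.
have := cardfsUI S S'.
have := e_card ST S'T; have := e_card S'T ST; rewrite (fsetUC S') (fsetIC S').
have := e_submod S S'.
have := fsubset_leq_card (fsubsetIl S S').
have := fsubset_leq_card (fsubsetIr S S').
have := e_mono (fsubsetIl S S'); have := e_mono (fsubsetIr S S').
have := e_defect ST S'T.
move: (rk M A) (rk M B) (rk M (A `|` B)) (rk M (A `&` B)).
move: (mu A) (mu B) (mu (A `|` B)) (mu (A `&` B)).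
move: (e S) (e S') (e (S `|` S')) (e (S `&` S')).
move: #|` S| #|` S'| #|` S `|` S'| #|` S `&` S'|.
move=> *; lia.
Qed.

Lemma exists_extend : exists N : matroid K,
  [/\ ground N = E `|` T, extension N M
    & forall X S, X `<=` E -> S `<=` T ->
        rk N (X `|` S) = minn (minn (rk M X + #|` S|) (mu X + e S)) R].
Proof.
pose N := Matroid extend_rk_card extend_rk_mono extend_rk_submod.
have rkE X S : X `<=` E -> S `<=` T ->
    rk N (X `|` S) = minn (minn (rk M X + #|` S|) (mu X + e S)) R.
  move=> XE ST; rewrite /= /extend_rk !fsetIUl.
  have -> : S `&` E = fset0 by apply/eqP; rewrite -fsubset0 -ET fsetIC fsetIS.
  have -> : X `&` T = fset0 by apply/eqP; rewrite -fsubset0 -ET fsetSI.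
  by rewrite fsetU0 fset0U (fsetIidPl XE) (fsetIidPl ST).
exists N; split=> //; split=> [|X XE]; first exact: fsubsetUl.
rewrite -[X in rk N X]fsetU0 rkE ?fsub0set // cardfs0.
have := rk_mono XE (fsubset_refl E); have := rk_le_mu XE; lia.
Qed.

End Extend.

(** * Least rank of a flat in a given family *)

Section CutRank.
Variables (K : choiceType) (M : matroid K) (D : {fset {fset K}}).
Local Notation E := (ground M).

(** The default [rk M E] is harmless once [E] is in [D]. *)
Definition cut_rk (X : {fset K}) :=
  \big[minn/rk M E]_(F <- D | X `<=` F) rk M F.

Lemma cut_rk_le X F : F \in D -> X `<=` F -> cut_rk X <= rk M F.
Proof.
rewrite /cut_rk -[F \in D]/(F \in enum_fset D); move: (enum_fset D) => s.
elim: s => // G s IHs; rewrite inE big_cons => /orP [/eqP <- -> | Fs XF].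
  exact: geq_minl.
by case: ifP => _; rewrite ?geq_min IHs ?orbT.
Qed.

Hypotheses (ED : E \in D) (subE : forall F, F \in D -> F `<=` E).

Lemma cut_rk_attained X : X `<=` E ->
  exists2 F, F \in D & X `<=` F /\ cut_rk X = rk M F.
Proof.
move=> XE; rewrite /cut_rk big_seq_cond.
elim/big_ind: _ => [|x y [F FD [XF ->]] [G GD [XG ->]]|F /andP [FD XF]].
- by exists E.
- by case: (leqP (rk M F) (rk M G)) => _; [exists F | exists G].
- by exists F.
Qed.

Lemma rk_le_cut_rk X : X `<=` E -> rk M X <= cut_rk X.
Proof.
by move=> /cut_rk_attained [F FD [XF ->]]; apply: rk_mono (subE FD).
Qed.

Lemma cut_rk_mono X Y : X `<=` Y -> Y `<=` E -> cut_rk X <= cut_rk Y.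
Proof.
move=> XY /cut_rk_attained [F FD [YF ->]].
exact: cut_rk_le (fsubset_trans XY YF).
Qed.

Hypothesis upD : forall F X, F \in D -> X `<=` E ->
  exists2 G, G \in D & F `|` X `<=` G /\ rk M G = rk M (F `|` X).

Lemma cut_rk_le_fsetU F X Y : F \in D -> Y `<=` E -> X `<=` F `|` Y ->
  cut_rk X <= rk M (F `|` Y).
Proof.
move=> FD YE XFY; have [G GD [FYG <-]] := upD FD YE.
exact: cut_rk_le (fsubset_trans XFY FYG).
Qed.

(** For [F] optimal for [Y], [upD] gives a member of [D] with the rank of the union of [F] and [X],
    so submodularity of [rk M] at [X] and [F] suffices. *)
Lemma cut_rk_rk_submod X Y : X `<=` E -> Y `<=` E ->
  cut_rk (X `|` Y) + rk M (X `&` Y) <= rk M X + cut_rk Y.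
Proof.
move=> XE YE; have [F FD [YF ->]] := cut_rk_attained YE.
have := @cut_rk_le_fsetU F (X `|` Y) X FD XE.
rewrite (fsetUC F) fsetUS // => /(_ isT).
have := rk_submod XE (subE FD).
have := rk_mono (fsetIS X YF) (fsubset_trans (fsubsetIl X F) XE); lia.
Qed.

Variable d : nat.
Hypothesis defectD : forall F G, F \in D -> G \in D -> F `&` G \notin D ->
  rk M (F `|` G) + rk M (F `&` G) + d <= rk M F + rk M G.

(** For optimal [F] and [G], the intersection either lies in [D] and bounds [cut_rk], or [defectD]
    gains the extra [d]. *)
Lemma cut_rk_submod X Y : X `<=` E -> Y `<=` E ->
  cut_rk (X `|` Y) + minn (cut_rk (X `&` Y)) (rk M (X `&` Y) + d)
    <= cut_rk X + cut_rk Y.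
Proof.
move=> XE YE; have [F FD [XF ->]] := cut_rk_attained XE.
have [G GD [YG ->]] := cut_rk_attained YE.
have leU := cut_rk_le_fsetU FD (subE GD) (fsetUSS XF YG).
have sI := fsetISS XF YG; have FGE := fsubset_trans (fsubsetIl F G) (subE FD).
have leI := rk_mono sI FGE; have := rk_submod (subE FD) (subE GD).
case: (boolP (F `&` G \in D)) => [FGD | /(defectD FD GD)]; last lia.
have := cut_rk_le FGD sI; lia.
Qed.

End CutRank.

(** * Modular defects in a cut *)

Section Defect.
Variables (K : choiceType) (M : matroid K).
Local Notation E := (ground M).

Definition defect (F G : {fset K}) :=
  rk M F + rk M G - (rk M (F `|` G) + rk M (F `&` G)).

(** If [C] is closed under intersection, a member of least cardinality lies in all the others and
    generates [C]. *)
Lemma principal_or_pair C : modular_cut M C -> C <> fset0 ->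
  principal M C \/
  exists F1 F2, [/\ F1 \in C, F2 \in C, F1 `&` F2 \notin C
    & forall F G, F \in C -> G \in C -> F `&` G \notin C ->
        defect F1 F2 <= defect F G].
Proof.
move=> [Cflat Cup _] /eqP /fset0Pn [F0 F0C].
pose bad (p : C * C) := val p.1 `&` val p.2 \notin C.
case: (pickP bad) => [p0 bad0 | nobad].
  right; case: (arg_minnP (fun p : C * C => defect (val p.1) (val p.2)) bad0).
  move=> [F1 F2] /= bad12 min12; exists (val F1), (val F2); split.
  - exact: valP.
  - exact: valP.
  - exact: bad12.
  - by move=> F G FC GC FG; apply: (min12 ([` FC], [` GC])).
have capC F G : F \in C -> G \in C -> F `&` G \in C.
  by move=> FC GC; have /negbFE := nobad ([` FC], [` GC]).
left; have [F _ minF] := @arg_minnP C [` F0C] predT (fun F => #|` val F|) isT.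
exists (val F); first exact/Cflat/valP.
move=> G; split=> [GC | [fG FG]]; last exact: Cup (valP F) fG FG.
split; first exact: Cflat.
have leF := minF [` capC _ _ (valP F) GC] isT.
apply/fsetIidPl/eqP.
by rewrite eqEfcard fsubsetIl leF.
Qed.

Lemma defectE F G : F `<=` E -> G `<=` E ->
  rk M (F `|` G) + rk M (F `&` G) + defect F G = rk M F + rk M G.
Proof. by move=> FE GE; rewrite /defect subnKC // rk_submod. Qed.

Lemma rk_lt_fsetU_flat F G :
  flat M G -> F `<=` E -> ~~ (F `<=` G) -> rk M G < rk M (F `|` G).
Proof.
move=> [GE fG] FE /fsubsetPn [x xF xG].
apply: leq_trans (fG x (fsubsetP FE x xF) xG) _.
by apply: rk_mono; [rewrite fsetSU ?fsub1set | rewrite fsubUset FE].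
Qed.

(** If [G] and [H] in [C] meet outside [C], their defect is at least [d] and their union outranks
    [H], so [G] outranks the intersection by more than [d]. This applies to [F] and [F1], or else to
    their intersection and [F2]. *)
Lemma cut_rk_gt_defect C d F1 F2 F : modular_cut M C ->
  (forall F G, F \in C -> G \in C -> F `&` G \notin C -> d <= defect F G) ->
  F1 \in C -> F2 \in C -> F1 `&` F2 \notin C ->
  F \in C -> F1 `&` F2 `<=` F -> rk M (F1 `&` F2) + d < rk M F.
Proof.
move=> [Cflat Cup _] min_d F1C F2C IC.
have step G H : G \in C -> H \in C -> F1 `&` F2 `<=` G `&` H ->
    G `&` H \notin C -> rk M (F1 `&` F2) + d < rk M G.
  move=> GC HC IGH GHC; have [GE _] := Cflat G GC; have [HE _] := Cflat H HC.
  have := min_d G H GC HC GHC; have := defectE GE HE.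
  have := rk_mono IGH (fsubset_trans (fsubsetIl G H) GE).
  have := rk_lt_fsetU_flat (Cflat H HC) GE.
  case: (boolP (G `<=` H)) => [/fsetIidPl GH | _ /(_ isT)]; last lia.
  by rewrite GH GC in GHC.
move=> FC IF; case: (boolP (F `&` F1 \in C)) => FF1C; last first.
  by apply: step FC F1C _ FF1C; rewrite fsubsetI IF fsubsetIl.
have [FE _] := Cflat F FC.
apply: leq_trans (rk_mono (fsubsetIl F F1) FE).
have FF1I : F `&` F1 `&` F2 = F1 `&` F2 by rewrite -fsetIA; apply/fsetIidPr.
by apply: step FF1C F2C _ _; rewrite FF1I.
Qed.

End Defect.

(* Every element of [P] lies in the closures of both [F1] and [F2], so
   when these become a modular pair after adding [Q], it lies in the closure of
   [F1 `&` F2 `|` Q]. *)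
Lemma rk_fsetIU_bound (K : choiceType) (A : matroid K) (F1 F2 P Q : {fset K})
    (s : nat) :
  F1 `<=` ground A -> F2 `<=` ground A -> P `<=` ground A -> Q `<=` ground A ->
  rk A (F1 `|` P) <= rk A F1 -> rk A (F2 `|` P) <= rk A F2 ->
  rk A (F1 `|` Q) <= rk A F1 + s -> rk A (F2 `|` Q) <= rk A F2 + s ->
  rk A (F1 `|` F2) + s <= rk A (F1 `|` F2 `|` Q) ->
  rk A (F1 `&` F2 `|` Q `|` P) + rk A (F1 `|` F2) <= rk A F1 + rk A F2 + s.
Proof.
move=> F1E F2E PE QE; set E := ground A in F1E F2E PE QE *.
have UE X Y : X `<=` E -> Y `<=` E -> X `|` Y `<=` E.
  by move=> XE YE; rewrite fsubUset XE.
have absorb F : F `<=` E -> rk A (F `|` P) <= rk A F ->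
    rk A (F `|` Q `|` P) <= rk A (F `|` Q).
  move=> FE; have := rk_submod (UE _ _ FE QE) (UE _ _ FE PE).
  rewrite -fsetUIr fsetUACA fsetUid fsetUA.
  have := rk_mono (fsubsetUl F (Q `&` P))
    (UE _ _ FE (fsubset_trans (fsubsetIl Q P) QE)); lia.
move=> /(absorb F1 F1E) h1 /(absorb F2 F2E) h2 h3 h4.
have F1QE := UE _ _ (UE _ _ F1E QE) PE; have F2QE := UE _ _ (UE _ _ F2E QE) PE.
have := rk_submod F1QE F2QE; rewrite -!fsetUIl => h5 h6.
have sub : F1 `|` F2 `|` Q `<=` F1 `|` Q `|` P `|` (F2 `|` Q `|` P).
  by apply/fsubsetP => x; rewrite !inE => /orP [/orP[]|] ->; rewrite ?orbT.
have := rk_mono sub (UE _ _ F1QE F2QE); lia.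
Qed.

(** * Two extensions without an amalgam *)

Theorem theorem9 (K : choiceType) (HK : infinite_universe K) (M : matroid K) :
  ~ OTE M -> ~ sticky M.
Proof.
move=> notOTE stickyM; apply: notOTE => C cutC C0.
have [//|[F1 [F2 [F1C F2C IC min_d]]]] := principal_or_pair cutC C0; exfalso.
have gt_d := cut_rk_gt_defect cutC min_d F1C F2C IC.
have [Cflat Cup Cmod] := cutC.
have CE F : F \in C -> F `<=` ground M by case/Cflat.
have [F1E F2E] := (CE _ F1C, CE _ F2C).
set d := defect M F1 F2 in min_d gt_d; set I := F1 `&` F2 in IC gt_d.
have IE : I `<=` ground M by apply: fsubset_trans F1E; apply: fsubsetIl.
have UE : F1 `|` F2 `<=` ground M by rewrite fsubUset F1E.
have d12 : rk M (F1 `|` F2) + rk M I + d = rk M F1 + rk M F2 by exact: defectE.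
have d_gt0 : 0 < d.
  rewrite lt0n; apply: contraNneq IC => d0; apply: Cmod => //.
  by rewrite /modular_pair -d12 d0 addn0.
(* Restricting to flats above [I] makes [mu] exceed [rk M I + d] everywhere. *)
pose D := [fset F in C | I `<=` F].
have inD F : (F \in D) = (F \in C) && (I `<=` F) by rewrite !inE.
have upD F X : F \in D -> X `<=` ground M ->
    exists2 G, G \in D & F `|` X `<=` G /\ rk M G = rk M (F `|` X).
  rewrite inD => /andP [FC IF] XE.
  have [|G [fG sG rG]] := @exists_flat_span _ M (F `|` X).
    by rewrite fsubUset CE.
  have FG : F `<=` G := fsubset_trans (fsubsetUl F X) sG.
  by exists G; rewrite // inD (Cup F) // (fsubset_trans IF).
have subD F : F \in D -> F `<=` ground M by rewrite inD => /andP [/CE].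
have F1D : F1 \in D by rewrite inD F1C fsubsetIl.
have F2D : F2 \in D by rewrite inD F2C fsubsetIr.
have ED : ground M \in D.
  have [G GD [sG _]] := upD F1 (ground M) F1D (fsubset_refl _).
  suff -> : ground M = G by [].
  apply/eqP; rewrite eqEfsubset (subD _ GD) andbT.
  exact: fsubset_trans (fsubsetUr F1 _) sG.
have defectD F G : F \in D -> G \in D -> F `&` G \notin D ->
    rk M (F `|` G) + rk M (F `&` G) + d <= rk M F + rk M G.
  rewrite !inD => /andP [FC IF] /andP [GC IG].
  rewrite fsubsetI IF IG !andbT => /(min_d F G FC GC) le_d.
  by rewrite -(defectE (CE _ FC) (CE _ GC)) leq_add2l.
pose mu := cut_rk M D.
have mu_ge X : X `<=` ground M -> rk M I + d + 1 <= mu X.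
  move=> /(cut_rk_attained ED) [F + [_ eF]]; rewrite /mu eF addn1 inD.
  by case/andP; apply: gt_d.
have mu1 : mu F1 <= rk M F1 by apply: cut_rk_le.
have mu2 : mu F2 <= rk M F2 by apply: cut_rk_le.
(* As the cap of [N1], the full rank truncates nothing; in [N2] it keeps [R] above [rk M F + s] for
   every flat [F]. *)
pose s := rk M (ground M).
have ext := @exists_extend K M mu d (rk M I + d + 1)
  (rk_le_cut_rk ED subD) (cut_rk_mono ED) (cut_rk_rk_submod ED subD upD)
  (cut_rk_submod ED subD upD defectD) mu_ge.
have [P cP EP] := exists_fresh_fset HK (ground M) d.
have [Q cQ EPQ] := exists_fresh_fset HK (ground M `|` P) (d + s).
have [Q' cQ' EPQQ'] := exists_fresh_fset HK (ground M `|` P `|` Q) (d + s).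
(* With [e] zero, [P] lies in the closure of every flat of [D]. *)
have [|||||N1 [gN1 extN1 rkN1]] := ext P (fun=> 0) s EP.
- exact: leqnn.
- by [].
- by move=> S S' _ _; rewrite add0n addn0 fsubset_leq_card ?fsubsetIl.
- by [].
- move=> S S' SP _; left; rewrite !addn0 -cP.
  exact/fsubset_leq_card/(fsubset_trans (fsubsetIl S S')).
(* [R] is just large enough to make [I `|` Q `|` Q'] violate submodularity, and
   small enough for a flat of [D] to have rank [R] with [Q `|` Q'] added, which
   is the second alternative of [e_defect]. *)
pose R := 2 * s + rk M I + d + 1.
(* On subsets of the new elements, this is the rank in the direct sum of the uniform matroids of
   rank [s] on [Q] and [Q']. *)
pose e (S : {fset K}) := minn #|` S `&` Q| s + minn #|` S `&` Q'| s.
have EQQ' : ground M `&` (Q `|` Q') = fset0.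
  apply/eqP; move/eqP: EPQ; move/eqP: EPQQ'.
  rewrite !fsetI_eq0 !fdisjointUX !fdisjointXU.
  by move=> /andP [/andP [-> _] _] /andP [->].
have QQ' : Q `&` Q' = fset0.
  apply/eqP; move/eqP: EPQQ'.
  by rewrite !fsetI_eq0 !fdisjointUX => /andP [_ ->].
have splitQ S : S `<=` Q `|` Q' -> #|` S| = #|` S `&` Q| + #|` S `&` Q'|.
  move=> /fsetIidPl {1}<-; rewrite fsetIUr -cardfsUI fsetIACA QQ' fsetI0.
  by rewrite cardfs0 addn0.
have cardI (S S' U : {fset K}) :
    #|` (S `|` S') `&` U| + #|` (S `&` S') `&` U|
      = #|` S `&` U| + #|` S' `&` U|.
  by rewrite -(cardfsUI (S `&` U)) -fsetIUl (fsetIACA S U) fsetIid.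
have leI (S S' U : {fset K}) : S `<=` S' -> #|` S `&` U| <= #|` S' `&` U|.
  by move=> SS'; apply/fsubset_leq_card/fsetSI.
have leQ (U S : {fset K}) : #|` S `&` U| <= #|` U|.
  exact/fsubset_leq_card/fsubsetIr.
have [|||||N2 [gN2 extN2 rkN2]] := ext (Q `|` Q') e R EQQ'.
- by rewrite /R -/s; clear; lia.
- move=> S S' SS'; rewrite /e.
  by have := leI S S' Q SS'; have := leI S S' Q' SS'; clear; lia.
- move=> S S' ST S'T.
  have IT : S `&` S' `<=` Q `|` Q' := fsubset_trans (fsubsetIl S S') ST.
  rewrite (splitQ _ ST) (splitQ _ IT) /e.
  have := cardI S S' Q; have := cardI S S' Q'.
  have := leI _ _ Q (fsubsetIl S S'); have := leI _ _ Q' (fsubsetIl S S').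
  have := leI _ _ Q (fsubsetIr S S'); have := leI _ _ Q' (fsubsetIr S S').
  clear; lia.
- move=> S S'; rewrite /e.
  have := cardI S S' Q; have := cardI S S' Q'.
  have := leI _ _ Q (fsubsetIl S S'); have := leI _ _ Q' (fsubsetIl S S').
  have := leI _ _ Q (fsubsetIr S S'); have := leI _ _ Q' (fsubsetIr S S').
  clear; lia.
(* The parts of the intersection in [Q] and [Q'] exceed [s] by at most [d] each. If both exceed it,
   [e S] and [e S'] equal [2 * s] and the cap [R] applies; otherwise one [d] is enough. *)
- move=> S S' ST S'T.
  have IT : S `&` S' `<=` Q `|` Q' := fsubset_trans (fsubsetIl S S') ST.
  rewrite (splitQ _ IT) /e /R.
  have := cardI S S' Q; have := cardI S S' Q'.
  have := leQ Q (S `&` S'); have := leQ Q' (S `&` S'); rewrite cQ cQ'.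
  have := leI _ _ Q (fsubsetIl S S'); have := leI _ _ Q' (fsubsetIl S S').
  have := leI _ _ Q (fsubsetIr S S'); have := leI _ _ Q' (fsubsetIr S S').
  clear; lia.
have gN12 : ground N1 `&` ground N2 = ground M.
  rewrite gN1 gN2; apply/fsetP => x; rewrite !inE.
  have /fsetP /(_ x) := EPQ; have /fsetP /(_ x) := EPQQ'; rewrite !inE.
  by case: (x \in ground M); case: (x \in P); case: (x \in Q); case: (x \in Q').
have [A [gA [N1A rkA1] [N2A rkA2]]] := stickyM N1 N2 extN1 extN2 gN12.
rewrite gN1 in gA N1A rkA1; rewrite gN2 in gA N2A rkA2.
have EA : ground M `<=` ground A := fsubset_trans (fsubsetUl _ P) N1A.
have PA : P `<=` ground A := fsubset_trans (fsubsetUr _ P) N1A.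
have QQ'A : Q `|` Q' `<=` ground A := fsubset_trans (fsubsetUr _ _) N2A.
have QA : Q `<=` ground A := fsubset_trans (fsubsetUl _ _) QQ'A.
have Q'A : Q' `<=` ground A := fsubset_trans (fsubsetUr _ _) QQ'A.
have rkA X : X `<=` ground M -> rk A X = rk M X.
  move=> XE; rewrite rkA1 ?extN1.2 //.
  exact: fsubset_trans XE (fsubsetUl _ _).
have rkAP X : X `<=` ground M ->
    rk A (X `|` P) = minn (minn (rk M X + d) (mu X)) s.
  by move=> XE; rewrite rkA1 ?fsetSU // rkN1 // cP addn0.
have rkAQ X S : X `<=` ground M -> S `<=` Q `|` Q' ->
    rk A (X `|` S) = minn (minn (rk M X + #|` S|) (mu X + e S)) R.
  by move=> XE ST; rewrite rkA2 ?fsetUSS // rkN2.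
(* The [mu] term limits the gain over [F1] and [F2] to [s], while every term allows a gain of [s]
   over their union. *)
have boundQ S : S `<=` Q `|` Q' -> #|` S| = d + s -> e S = s ->
    rk A (I `|` S `|` P) <= rk M I + d + s.
  move=> ST cS eS.
  have SA := fsubset_trans ST QQ'A.
  have muU : rk M (F1 `|` F2) <= mu (F1 `|` F2) := rk_le_cut_rk ED subD UE.
  have le_s : rk M (F1 `|` F2) <= s := rk_mono UE (fsubset_refl _).
  have := @rk_fsetIU_bound K A F1 F2 P S s (fsubset_trans F1E EA)
    (fsubset_trans F2E EA) PA SA.
  rewrite (rkAP F1) // (rkAP F2) // (rkAQ F1 S) // (rkAQ F2 S) //.
  rewrite (rkAQ (F1 `|` F2) S) // (rkA F1) // (rkA F2) //.
  rewrite (rkA (F1 `|` F2)) // cS eS -/I /R.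
  move: d12 muU le_s mu1 mu2; clear; lia.
have eQ : e Q = s.
  by rewrite /e fsetIid QQ' cardfs0 cQ; clear; lia.
have eQ' : e Q' = s.
  by rewrite /e fsetIid fsetIC QQ' cardfs0 cQ'; clear; lia.
have eQQ' : e (Q `|` Q') = s + s.
  rewrite /e (fsetIidPr (fsubsetUl Q Q')) (fsetIidPr (fsubsetUr Q Q')) cQ cQ'.
  clear; lia.
have cQQ' : #|` Q `|` Q'| = d + s + (d + s).
  by have := cardfsUI Q Q'; rewrite QQ' cardfs0 addn0 cQ cQ'.
have bQ := boundQ Q (fsubsetUl _ _) cQ eQ.
have bQ' := boundQ Q' (fsubsetUr _ _) cQ' eQ'.
have IA := fsubset_trans IE EA.
have IQPA : I `|` Q `|` P `<=` ground A by rewrite !fsubUset IA QA.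
have IQ'PA : I `|` Q' `|` P `<=` ground A by rewrite !fsubUset IA Q'A.
have := rk_submod IQPA IQ'PA.
have sU : I `|` (Q `|` Q') `<=` (I `|` Q `|` P) `|` (I `|` Q' `|` P).
  by apply/fsubsetP => x; rewrite !inE => /or3P [] ->; rewrite ?orbT.
have UA : (I `|` Q `|` P) `|` (I `|` Q' `|` P) `<=` ground A.
  by rewrite fsubUset IQPA.
have sI : I `|` P `<=` (I `|` Q `|` P) `&` (I `|` Q' `|` P).
  by rewrite fsubsetI !fsetSU ?fsubsetUl.
have := rk_mono sU UA.
have := rk_mono sI (fsubset_trans (fsubsetIl _ _) IQPA).
(* The first rank is [rk M I + d]; the second is [R], where [d_gt0] keeps the free term from being
   smaller. Submodularity then fails by exactly one. *)
rewrite (rkAP I) // (rkAQ I (Q `|` Q')) // eQQ' cQQ' /R.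
have := mu_ge I IE; have := mu_ge _ UE.
have := rk_mono UE (fsubset_refl _); rewrite -/s.
have := gt_d F1 F1C (fsubsetIl F1 F2).
have := rk_mono F1E (fsubset_refl _); rewrite -/s.
move: d_gt0 bQ bQ'; clear; lia.
Qed.
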